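(* Let $\mathcal{K}$ be a discrete valued field with valuation $\nu:\mathcal{K}\to\mathbb{Z}$ and finite residue field $\mathbb{F}_q$, let $n\geq 1$ and let $2\leq \ell\leq k$ be integers. Then: \begin{enumerate} \item $\left\lfloor \frac{(k-1)(q-1)}{q^{\ell-1}-1}\right\rfloor\frac{q^n-1}{q-1}\leq \Theta_{n}^{(k,\ell)}\leq \left\lfloor \frac{k-1}{q^{\ell-1}-1}\cdot (q^n-1)\right\rfloor$. As a consequence, if $\frac{q^{\ell-1}-1}{q-1}$ divides $k-1$, then $\Theta_{n}^{(k,\ell)}=\frac{k-1}{q^{\ell-1}-1}(q^n-1)$. Moreover, $\lim_{k\to\infty}\frac{\Theta_n^{(k,\ell)}}{k}=\frac{q^n-1}{q^{\ell-1}-1}$. \item $\Theta_n^{(k,\ell)}=\Delta_n^{(k,\ell)}$ if and only if $\ell=2$. \item If $\Theta_{n}^{(k,\ell)}=\mathrm{Ind}_q(n,k,\ell)$, then $k\leq q^{\ell-1}$. \end{enumerate}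
   Context: The absolute value on $\mathcal{K}$ is $|\lambda|=q^{-\nu(\lambda)}$, and $\mathcal{K}^n$ carries the norm $\Vert \mathbf{v}\Vert=\max_i|v_i|$. Let $\mathbb{B}_n=\{\mathbf{v}\in\mathcal{K}^n:\Vert\mathbf{v}\Vert=1\}$. Nonzero vectors $\mathbf{u}_1,\dots,\mathbf{u}_\ell\in\mathcal{K}^n$ are orthogonal if $\Vert\sum_i\lambda_i\mathbf{u}_i\Vert=\max_i\Vert\lambda_i\mathbf{u}_i\Vert$ for all $\lambda_i\in\mathcal{K}$; they are weakly orthogonal if they are pairwise orthogonal. For $2\le\ell\le k$, a set $S\subseteq\mathcal{K}^n\setminus\{\mathbf 0\}$ is $(k,\ell)$-orthogonal (resp. $(k,\ell)$-weakly orthogonal) if every $E\subseteq S$ with $|E|=k$ contains an orthogonal (resp. weakly orthogonal) subset of size $\ell$. $\Theta_n^{(k,\ell)}$ (resp. $\Delta_n^{(k,\ell)}$) is the maximum size of a $(k,\ell)$-orthogonal (resp. $(k,\ell)$-weakly orthogonal) subset of $\mathbb{B}_n$. $\mathrm{Ind}_q(n,k,\ell)$ is the maximum size of a set $S\subset\mathbb{F}_q^n\setminus\{\mathbf 0\}$ such that every $X\subseteq S$ of size $k$ satisfies $\dim_{\mathbb{F}_q}\operatorname{span}(X)\ge\ell$.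
   Formalization: In (1) the upper bound, exact value and limit are stated for ℓ ≤ n+1 (for larger ℓ, Θ = k−1 and they fail, e.g. n=1, ℓ=k=3); (2) is stated for ℓ ≤ max(2,(q^n−1)/(q−1)), since beyond that Θ = Δ = k−1 although ℓ ≠ 2. *)

(* Defs.v *)
From HB Require Import structures.
From mathcomp Require Import all_boot all_order all_algebra.
From mathcomp Require Import finmap.
From mathcomp Require Import all_classical all_reals all_analysis.

Set Implicit Arguments.
Unset Strict Implicit.
Unset Printing Implicit Defensive.
Import Order.TTheory GRing.Theory Num.Theory.
Import numFieldNormedType.Exports.

Local Open Scope classical_set_scope.
Local Open Scope ring_scope.

(* The value nu 0 is unconstrained (mathematically it is +oo), so every use of
   nu treats 0 apart. The valuation is not required to be normalised, i.e. onto
   int, only to be nontrivial. *)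
Record discrete_valuation (K : fieldType) (nu : K -> int) : Prop := {
  valuationM : forall x y : K, x != 0 -> y != 0 -> nu (x * y) = nu x + nu y ;
  valuationD : forall x y : K, x != 0 -> y != 0 -> x + y != 0 ->
    Num.min (nu x) (nu y) <= nu (x + y) ;
  valuation_nontrivial : exists2 x : K, x != 0 & nu x != 0 }.

Definition valuation_ring (K : fieldType) (nu : K -> int) : {pred K} :=
  [pred x | (x == 0) || (0 <= nu x)].

Definition valuation_ideal (K : fieldType) (nu : K -> int) : {pred K} :=
  [pred x | (x == 0) || (0 < nu x)].

(* res restricts to a surjective ring morphism from the valuation ring to F
   whose kernel is the maximal ideal, i.e. it identifies F with the residue
   field; the values of res outside the valuation ring are irrelevant. *)
Record residue_map (K : fieldType) (nu : K -> int) (F : fieldType)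
    (res : K -> F) : Prop := {
  residue1 : res 1 = 1 ;
  residueD : {in valuation_ring nu &, {morph res : x y / x + y}} ;
  residueM : {in valuation_ring nu &, {morph res : x y / x * y}} ;
  residue_surj : forall a : F, exists2 x, x \in valuation_ring nu & res x = a ;
  residue_ker : {in valuation_ring nu, forall x,
    (res x == 0) = (x \in valuation_ideal nu)} }.

Definition residue_field (K : fieldType) (nu : K -> int) (F : fieldType) : Prop :=
  exists res : K -> F, residue_map nu res.

Section Orthogonality.
Variables (R : realType) (K : fieldType) (q : nat) (nu : K -> int).

Definition absv (x : K) : R := if x == 0 then 0 else q%:R ^ (- nu x).

Variable n : nat.

Definition vnorm (v : 'rV[K]_n) : R := \big[Num.max/0]_(i < n) absv (v 0 i).

Definition unit_vectors : set 'rV[K]_n := [set v | vnorm v = 1].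

Definition norm_orthogonal (A : {fset 'rV[K]_n}) : Prop :=
  (forall u, u \in A -> u != 0) /\
  forall c : 'rV[K]_n -> K,
    vnorm (\sum_(u <- A) c u *: u) = \big[Num.max/0]_(u <- A) vnorm (c u *: u).

Definition norm_weakly_orthogonal (A : {fset 'rV[K]_n}) : Prop :=
  (forall u, u \in A -> u != 0) /\
  forall u v, u \in A -> v \in A -> u != v -> norm_orthogonal [fset u; v]%fset.

Definition kl_set (orth : {fset 'rV[K]_n} -> Prop) (k l : nat)
    (S : set 'rV[K]_n) : Prop :=
  S `<=` [set v | v != 0] /\
  forall E : {fset 'rV[K]_n}, [set` E] `<=` S -> #|` E| = k ->
    exists A : {fset 'rV[K]_n}, [/\ (A `<=` E)%fset, #|` A| = l & orth A].

Definition kl_orthogonal := kl_set norm_orthogonal.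
Definition kl_weakly_orthogonal := kl_set norm_weakly_orthogonal.

(* Infinite sets are allowed in the family P, and exclude a maximum size. *)
Definition is_max_size (T : Type) (P : set (set T)) (m : nat) : Prop :=
  (exists2 S, P S & (S #= `I_m)%card) /\ (forall S, P S -> (S #<= `I_m)%card).

(* The value is 0 when there is no maximum. *)
Definition max_size (T : Type) (P : set (set T)) : nat :=
  xget 0%N [set m | is_max_size P m].

Definition Theta_family (k l : nat) : set (set 'rV[K]_n) :=
  [set S | S `<=` unit_vectors /\ kl_orthogonal k l S].

Definition Delta_family (k l : nat) : set (set 'rV[K]_n) :=
  [set S | S `<=` unit_vectors /\ kl_weakly_orthogonal k l S].

Definition Theta (k l : nat) : nat := max_size (Theta_family k l).
Definition Delta (k l : nat) : nat := max_size (Delta_family k l).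

End Orthogonality.

Arguments Theta_family R {K} q nu n k l _.
Arguments Delta_family R {K} q nu n k l _.

Definition kl_independent (F : finFieldType) (n k l : nat)
    (S : {set 'rV[F]_n}) : bool :=
  (0 \notin S) &&
  [forall X : {set 'rV[F]_n},
     (X \subset S) && (#|X| == k) ==> (l <= \dim <<enum X>>%VS)%N].

Definition Ind (F : finFieldType) (n k l : nat) : nat :=
  \max_(S : {set 'rV[F]_n} | kl_independent k l S) #|S|.

(* Main.v *)
(* Reduction modulo the maximal ideal maps a vector of norm 1 to a nonzero
   vector over the residue field F, and a set of such vectors is orthogonal iff
   its reductions are linearly independent. Its fibres are infinite, so
   Theta is the largest total weight on F^n \ {0} such that every subspace of
   dimension < l has weight at most k - 1. Averaging over the translates of an
   (l-1)-dimensional subspace under the general linear group gives the upper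
   bound, equal weights on the points of the projective space give the lower
   one. Pairwise orthogonality only asks for distinct projective points, so any
   l - 1 points must have weight at most k - 1: for l >= 3 an (l-1)-dimensional
   subspace has more than l - 1 points, which leaves room for one more vector.
   For k > q^(l-1), weight 1 everywhere plus one extra vector
   is admissible, whence Theta >= q^n > Ind. *)

Require Import Defs.
From HB Require Import structures.
From mathcomp Require Import all_boot all_order all_algebra.
From mathcomp Require Import finmap.
From mathcomp Require Import all_classical all_reals all_analysis.
From mathcomp Require Import finfield zify ring.

Set Implicit Arguments.
Unset Strict Implicit.
Unset Printing Implicit Defensive.
Import Order.TTheory GRing.Theory Num.Theory.
Import numFieldNormedType.Exports.

Local Open Scope ring_scope.

(** * Absolute value, norm and reduction *)

Section AbsoluteValue.
Variables (R : realType) (K : fieldType) (nu : K -> int) (q : nat).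
Hypotheses (nuP : discrete_valuation nu) (q_gt1 : (1 < q)%N).

Local Notation abs := (absv R q nu).

Let qR_gt1 : 1 < q%:R :> R. Proof. by rewrite ltr1n. Qed.
Let qR_gt0 : 0 < q%:R :> R. Proof. exact: lt_trans ltr01 qR_gt1. Qed.

Lemma absv0 : abs 0 = 0. Proof. by rewrite /absv eqxx. Qed.

Lemma absv_gt0 x : (0 < abs x) = (x != 0).
Proof. by rewrite /absv; case: eqP => _; rewrite ?ltxx// exprz_gt0. Qed.

Lemma absv_ge0 x : 0 <= abs x.
Proof. by case: (eqVneq x 0) => [->|x0]; rewrite ?absv0// ltW// absv_gt0. Qed.

Lemma absvM x y : abs (x * y) = abs x * abs y.
Proof.
case: (eqVneq x 0) => [->|x0]; first by rewrite mul0r absv0 mul0r.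
case: (eqVneq y 0) => [->|y0]; first by rewrite mulr0 absv0 mulr0.
rewrite /absv mulf_eq0 (negPf x0) (negPf y0)/= valuationM// opprD.
by rewrite expfzDr// gt_eqF.
Qed.

Lemma absv1 : abs 1 = 1.
Proof.
have abs1 : abs 1 != 0 by rewrite gt_eqF// absv_gt0 oner_neq0.
by apply: (mulfI abs1); rewrite -absvM !mulr1.
Qed.

Lemma absvV x : abs x^-1 = (abs x)^-1.
Proof.
case: (eqVneq x 0) => [->|x0]; first by rewrite invr0 absv0 invr0.
have abs1 : abs x != 0 by rewrite gt_eqF// absv_gt0.
by apply: (mulfI abs1); rewrite -absvM !divff// absv1.
Qed.

Lemma absvX x i : abs (x ^+ i) = abs x ^+ i.
Proof. by elim: i => [|i IH]; rewrite ?absv1// !exprS absvM IH. Qed.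

Lemma absvD x y : abs (x + y) <= Num.max (abs x) (abs y).
Proof.
case: (eqVneq x 0) => [->|x0]; first by rewrite add0r le_max lexx orbT.
case: (eqVneq y 0) => [->|y0]; first by rewrite addr0 le_max lexx.
case: (eqVneq (x + y) 0) => [->|xy0].
  by rewrite absv0 le_max absv_ge0.
rewrite /absv (negPf x0) (negPf y0) (negPf xy0) le_max !ler_eXz2l// !lerN2.
by rewrite -ge_min valuationD.
Qed.

Lemma absv_le1 x : (abs x <= 1) = (x \in valuation_ring nu).
Proof.
rewrite /absv inE; case: eqP => [_|_ /=]; first by rewrite ler01.
by rewrite -[1 in LHS](expr0z q%:R) ler_eXz2l// oppr_le0.
Qed.

Lemma absv_lt1 x : (abs x < 1) = (x \in valuation_ideal nu).
Proof.
rewrite /absv inE; case: eqP => [_|_ /=]; first by rewrite ltr01.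
by rewrite -[1 in LHS](expr0z q%:R) ltr_eXz2l// oppr_lt0.
Qed.

(** A nontrivial valuation has an element of absolute value different from 1, and either it or its
    inverse is small. The powers of [p] later separate infinitely many lifts of one residue
    vector. *)
Lemma absv_small : exists2 p, 0 < abs p & abs p < 1.
Proof.
have [x x0 nx] := valuation_nontrivial nuP.
have: abs x != 1.
  rewrite /absv (negPf x0) -(expr0z q%:R) (inj_eq (ieexprIz _ _))//.
    by rewrite oppr_eq0.
  by rewrite gt_eqF.
rewrite neq_lt => /orP[x1|x1]; first by exists x; rewrite ?absv_gt0.
by exists x^-1; rewrite ?absv_gt0 ?invr_eq0// absvV invf_lt1// (lt_trans ltr01).
Qed.

Variable n : nat.
Local Notation norm := (@vnorm R K q nu n).

Lemma vnorm_leP (v : 'rV[K]_n) M : 0 <= M ->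
  reflect (forall i, abs (v 0 i) <= M) (norm v <= M).
Proof.
by move=> M0; apply: (iffP (bigmax_leP _ _ _ _)) => [[_ H] i|H]; [exact: H|split].
Qed.

Lemma vnorm_ltP (v : 'rV[K]_n) M : 0 < M ->
  reflect (forall i, abs (v 0 i) < M) (norm v < M).
Proof.
by move=> M0; apply: (iffP (bigmax_ltP _ _ _ _)) => [[_ H] i|H]; [exact: H|split].
Qed.

Lemma vnorm_ge0 v : 0 <= norm v.
Proof. exact: bigmax_ge_id. Qed.

Lemma absv_le_vnorm (v : 'rV[K]_n) i : abs (v 0 i) <= norm v.
Proof. exact: (vnorm_leP _ (vnorm_ge0 v) (lexx _)). Qed.

Lemma vnorm0 : norm 0 = 0.
Proof.
apply/eqP; rewrite eq_le vnorm_ge0 andbT; apply/vnorm_leP => // i.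
by rewrite mxE absv0.
Qed.

Lemma vnormZ c v : norm (c *: v) = abs c * norm v.
Proof.
have le d w : norm (d *: w) <= abs d * norm w.
  apply/vnorm_leP => [|i]; first by rewrite mulr_ge0 ?absv_ge0 ?vnorm_ge0.
  by rewrite mxE absvM ler_wpM2l ?absv_ge0 ?absv_le_vnorm.
apply/eqP; rewrite eq_le le/=; case: (eqVneq c 0) => [->|c0].
  by rewrite absv0 mul0r vnorm_ge0.
by rewrite mulrC -ler_pdivlMr ?absv_gt0// mulrC -absvV -{1}[v](scalerK c0) le.
Qed.

Lemma vnormD u v : norm (u + v) <= Num.max (norm u) (norm v).
Proof.
apply/vnorm_leP => [|i]; first by rewrite le_max vnorm_ge0.
rewrite mxE (le_trans (absvD _ _))// ge_max !le_max !absv_le_vnorm//.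
by rewrite orbT.
Qed.

Lemma vnorm_sum (I : Type) (r : seq I) (f : I -> 'rV[K]_n) :
  norm (\sum_(i <- r) f i) <= \big[Num.max/0]_(i <- r) norm (f i).
Proof.
elim: r => [|i r IH]; first by rewrite !big_nil vnorm0.
rewrite !big_cons (le_trans (vnormD _ _))// ge_max !le_max lexx/=.
by rewrite IH orbT.
Qed.

End AbsoluteValue.

(** Coefficients are indexed by the elements of [r] rather than by positions, to match the
    definition of orthogonality. *)
Lemma free_mapP (F : fieldType) (vT : vectType F) (T : eqType) (f : T -> vT)
    (r : seq T) : uniq r ->
  reflect (forall a : T -> F, \sum_(u <- r) a u *: f u = 0 ->
             {in r, forall u, a u = 0})
          (free [seq f u | u <- r]).
Proof.
move=> r_uniq; have size_r : size [seq f u | u <- r] == size r by rewrite size_map.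
apply: (iffP (@freeP _ _ _ (Tuple size_r))) => /= H.
  move=> a a0 u ur; rewrite -index_mem in ur.
  rewrite -(nth_index u (_ : u \in r)) -?index_mem//.
  apply: (H (fun i => a (nth u r i)) _ (Ordinal ur)).
  rewrite -[RHS]a0 (big_nth u) big_mkord; apply: eq_bigr => i _.
  by rewrite (nth_map u).
move=> a a0 i; have u0 : T by case: (r) i => [[]|].
(* Coefficients given by position are read off at the index of [u]; the default 0 only occurs
   outside [r]. *)
have := H (fun u => oapp a 0 (insub (index u r))).
rewrite (big_nth u0) big_mkord => /(_ _ (nth u0 r i)).
rewrite mem_nth// index_uniq// valK; apply=> //.
rewrite -[RHS]a0; apply: eq_bigr => j _.
by rewrite index_uniq// valK/= (nth_map u0).
Qed.

Lemma bigmax_seq_attained (R : realDomainType) (T : eqType) (f : T -> R) (r : seq T) :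
  \big[Num.max/0]_(i <- r) f i = 0 \/
  exists2 i, i \in r & \big[Num.max/0]_(i <- r) f i = f i.
Proof.
elim: r => [|j r IH]; first by left; rewrite big_nil.
rewrite big_cons; case: leP => _.
  case: IH => [->|[i ir ->]]; first by left.
  by right; exists i => //; rewrite inE ir orbT.
by right; exists j => //; rewrite inE eqxx.
Qed.

Section Reduction.
Variables (R : realType) (K : fieldType) (nu : K -> int) (F : finFieldType).
Variable res : K -> F.
Hypotheses (nuP : discrete_valuation nu) (resP : residue_map nu res).
Variable n : nat.

Local Notation q := #|F|.
Local Notation abs := (absv R q nu).
Local Notation norm := (@vnorm R K q nu n).

(** Meaningful only on vectors of norm at most 1, since [res] is unconstrained off the valuation
    ring. *)
Definition red (v : 'rV[K]_n) : 'rV[F]_n := map_mx res v.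

Let q_gt1 : (1 < q)%N. Proof. exact: finNzRing_gt1. Qed.

Lemma res_ideal x : abs x <= 1 -> (res x == 0) = (abs x < 1).
Proof. by rewrite absv_le1// absv_lt1// => /(residue_ker resP). Qed.

Lemma res0 : res 0 = 0.
Proof. by apply/eqP; rewrite (residue_ker resP) inE eqxx. Qed.

Lemma red0 : red 0 = 0.
Proof. by apply/rowP => i; rewrite !mxE res0. Qed.

Lemma red_eq0 v : norm v <= 1 -> (red v == 0) = (norm v < 1).
Proof.
move=> v1; apply/eqP/(vnorm_ltP _ _ _ ltr01) => [v0 i|v0].
  rewrite -res_ideal; last exact: le_trans (absv_le_vnorm _ _ _ _ _) v1.
  by move/rowP/(_ i): v0; rewrite !mxE => ->.
apply/rowP => i; rewrite !mxE; apply/eqP; rewrite res_ideal ?v0//.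
exact: ltW.
Qed.

Lemma unit_vectorsP v :
  unit_vectors R q nu v <-> norm v <= 1 /\ red v != 0.
Proof.
split=> [/= v1|[v1]]; first by rewrite red_eq0 v1 ?ltxx.
by rewrite red_eq0// -leNgt => ?; apply/eqP; rewrite eq_le v1.
Qed.

Lemma redD u v : norm u <= 1 -> norm v <= 1 -> red (u + v) = red u + red v.
Proof.
move=> u1 v1; apply/rowP => i; rewrite !mxE (residueD resP)//.
all: by rewrite -(absv_le1 R _ q_gt1) (le_trans (absv_le_vnorm _ _ _ _ _)).
Qed.

Lemma redZ c v : abs c <= 1 -> norm v <= 1 -> red (c *: v) = res c *: red v.
Proof.
move=> c1 v1; apply/rowP => i; rewrite !mxE (residueM resP)//.
all: by rewrite -(absv_le1 R _ q_gt1)// (le_trans (absv_le_vnorm _ _ _ _ _)).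
Qed.

(** The norm bound is proved together with the formula because [redD] needs it for the tail of the
    sum at each induction step. *)
Lemma red_sum (r : seq 'rV[K]_n) c :
  {in r, forall u, abs (c u) <= 1} -> {in r, forall u, norm u <= 1} ->
  norm (\sum_(u <- r) c u *: u) <= 1 /\
  red (\sum_(u <- r) c u *: u) = \sum_(u <- r) res (c u) *: red u.
Proof.
move=> c1 r1; elim: r => [|u r IH] in c1 r1 *.
  rewrite !big_nil vnorm0// ler01; split=> //.
  exact: red0.
have [|v vr|IH1 IH2] := IH; [by move=> v vr; apply: c1; rewrite inE vr orbT| |].
  by apply: r1; rewrite inE vr orbT.
have ur : u \in u :: r by rewrite inE eqxx.
have cu1 : norm (c u *: u) <= 1.
  by rewrite vnormZ// mulr_ile1 ?absv_ge0 ?vnorm_ge0 ?c1 ?r1.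
rewrite !big_cons; split; last by rewrite redD// redZ ?c1 ?r1// IH2.
by rewrite (le_trans (vnormD _ _ _ _ _))// ge_max cu1.
Qed.

Lemma res_section :
  exists2 s : F -> K, forall x, abs (s x) <= 1 & forall x, res (s x) = x.
Proof.
have /choice[s sP] x : exists y, abs y <= 1 /\ res y = x.
  by have [y yO <-] := residue_surj resP x; exists y; rewrite absv_le1.
by exists s => x; have [] := sP x.
Qed.

(** A relation among the reductions lifts to a combination of norm below 1; orthogonality then makes
    every coefficient small, so it reduces to 0. Conversely, divide a combination by its largest
    coefficient: if its norm dropped, reduction would give a relation among free vectors with a
    coefficient equal to 1. *)
Lemma norm_orthogonalP (A : {fset 'rV[K]_n}) :
  {in A, forall u, unit_vectors R q nu u} ->
  norm_orthogonal R q nu A <-> free [seq red u | u <- A].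
Proof.
move=> A1; have normA u : u \in A -> norm u = 1 by move/A1.
have normA1 : {in A, forall u, norm u <= 1} by move=> u /normA ->.
split=> [[_ orthA]|freeA].
  apply/(free_mapP _ (fset_uniq A)) => a a0 u uA.
  have [s sO ress] := res_section.
  have [le1 redE] := @red_sum A (s \o a) (fun _ _ => sO _) normA1.
  have lt1 : norm (\sum_(v <- A) (s \o a) v *: v) < 1.
    rewrite -red_eq0// redE -[X in _ == X]a0; apply/eqP.
    by apply: eq_bigr => v _; rewrite /= ress.
  apply/eqP.
  rewrite -[a u]ress res_ideal//; apply: le_lt_trans lt1; rewrite orthA.
  have := le_bigmax_seq 0 u xpredT (fun v => norm ((s \o a) v *: v)) uA isT.
  by rewrite vnormZ// normA// mulr1.
split=> [u /normA u1|c].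
  apply/eqP => u0; move: u1; rewrite u0 vnorm0// => /eqP.
  by rewrite eq_sym oner_eq0.
apply/eqP; rewrite eq_le vnorm_sum//=.
have [->|[u0 u0A maxE]] := bigmax_seq_attained (fun u => norm (c u *: u)) A.
  exact: vnorm_ge0.
have cE u : u \in A -> norm (c u *: u) = abs (c u).
  by move=> /normA u1; rewrite vnormZ// u1 mulr1.
rewrite maxE cE//; case: (eqVneq (c u0) 0) => [->|c0].
  by rewrite absv0 vnorm_ge0.
have abs0 : 0 < abs (c u0) by rewrite absv_gt0.
pose d u := (c u0)^-1 * c u.
have d1 : {in A, forall u, abs (d u) <= 1}.
  move=> u uA; rewrite absvM// absvV// mulrC ler_pdivrMr// mul1r.
  rewrite -(cE u)// -(cE u0)// -maxE.
  exact: (le_bigmax_seq 0 u xpredT (fun v => norm (c v *: v)) uA isT).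
have [le1 redE] := red_sum d1 normA1.
have -> : \sum_(u <- A) c u *: u = c u0 *: \sum_(u <- A) d u *: u.
  by rewrite scaler_sumr; apply: eq_bigr => u _; rewrite scalerA mulVKf.
rewrite vnormZ// ler_pMr// leNgt -red_eq0// redE.
apply: contraL isT => /eqP d0.
have /eqP := (free_mapP _ (fset_uniq A) freeA) _ d0 u0 u0A.
by rewrite /d mulVf// (residue1 resP) oner_eq0.
Qed.

Lemma lift_exists : (0 < n)%N -> exists lift : 'rV[F]_n -> nat -> 'rV[K]_n,
  [/\ forall v i, red (lift v i) = v,
      forall v i, v != 0 -> unit_vectors R q nu (lift v i) &
      forall v i w j, lift v i = lift w j -> v = w /\ i = j].
Proof.
move=> n0.
have [s sO ress] := res_section.
have [p p0 p1] := absv_small R nuP q_gt1.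
(* The perturbation has norm below 1, hence does not affect the reduction; the exponent [i.+1]
   ensures this for [i = 0] too. Distinct powers of [p] make the lifts distinct. *)
pose lift v i : 'rV[K]_n := map_mx s v + const_mx (p ^+ i.+1).
have pi i : abs (p ^+ i.+1) < 1 by rewrite absvX// exprn_ilt1 ?absv_ge0.
have s1 v : norm (map_mx s v) <= 1 by apply/vnorm_leP => // i; rewrite mxE.
have c1 i : norm (const_mx (p ^+ i.+1)) < 1 by apply/vnorm_ltP => // j; rewrite mxE.
have liftO v i : norm (lift v i) <= 1.
  by rewrite (le_trans (vnormD _ _ _ _ _))// ge_max s1 ltW.
have redlift v i : red (lift v i) = v.
  rewrite redD ?s1 ?(ltW (c1 i))//.
  have /eqP -> : red (const_mx (p ^+ i.+1)) == 0 by rewrite red_eq0 ?(ltW (c1 i)).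
  by rewrite addr0; apply/rowP => j; rewrite !mxE ress.
exists lift; split=> [//|v i v0|v i w j eq_lift].
  by apply/unit_vectorsP; rewrite redlift.
have eq_vw : v = w by rewrite -(redlift v i) eq_lift redlift.
split=> //; move: eq_lift; rewrite eq_vw => /addrI/rowP/(_ (Ordinal n0)).
rewrite !mxE => /(congr1 abs); rewrite !absvX//.
by move=> /(ieexprIn p0 (negbT (lt_eqF p1)))[].
Qed.

End Reduction.

(** * Subspaces and lines over a finite field *)

Section Selection.
Variables (T : choiceType) (F : fieldType) (vT : vectType F).

Lemma span_subseq_free (f : T -> vT) (s : seq T) : exists s' : seq T,
  [/\ subseq s' s, free [seq f u | u <- s'] &
      <<[seq f u | u <- s']>>%VS = <<[seq f u | u <- s]>>%VS].
Proof.
elim: s => [|x s [s' [ss' frees' span_s']]]; first by exists [::]; rewrite nil_free.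
case: (boolP (f x \in <<[seq f u | u <- s]>>%VS)) => fx.
  exists s'; split=> //; first exact: subseq_trans ss' (subseq_cons _ _).
  by rewrite span_s' /= span_cons; apply/esym/addv_idPr; rewrite -memvE.
exists (x :: s'); rewrite /= eqxx free_cons span_s' fx; split=> //.
by rewrite !span_cons span_s'.
Qed.

Lemma uniq_map_subseq (X : eqType) (f : T -> X) (s : seq T) : exists s' : seq T,
  [/\ subseq s' s, uniq [seq f u | u <- s'] & [seq f u | u <- s'] =i [seq f u | u <- s]].
Proof.
elim: s => [|x s [s' [ss' us' eqs']]]; first by exists [::].
case: (boolP (f x \in [seq f u | u <- s])) => fx.
  exists s'; split=> //; first exact: subseq_trans ss' (subseq_cons _ _).
  by move=> y; rewrite eqs' /= inE; case: eqP => // ->.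
exists (x :: s'); rewrite /= eqxx us' eqs' fx; split=> //.
by move=> y; rewrite !inE eqs'.
Qed.

Lemma fset_of_subseq (E : {fset T}) (s : seq T) l : subseq s E -> (l <= size s)%N ->
  exists A : {fset T}, [/\ (A `<=` E)%fset, #|` A| = l & perm_eq A (take l s)].
Proof.
move=> sE ls; have uniq_s : uniq (take l s).
  by rewrite take_uniq// (subseq_uniq sE).
exists [fset x in take l s]%fset; split.
- by apply/fsubsetP => x; rewrite inE => /mem_take/(mem_subseq sE).
- by rewrite card_fseq undup_id// size_takel.
- by apply: uniq_perm => // x; rewrite inE.
Qed.

Lemma exists_fsubset (E : {fset T}) k : (k <= #|` E|)%N ->
  exists2 A : {fset T}, (A `<=` E)%fset & #|` A| = k.
Proof. by move=> /(fset_of_subseq (subseq_refl _))[A [AE Ak _]]; exists A. Qed.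

(** A basis of the span can be selected among the vectors and truncated to length [l]. This turns
    the search for an orthogonal subset into a rank condition. *)
Lemma exists_free_fsubset (f : T -> vT) (E : {fset T}) l :
  (exists A : {fset T}, [/\ (A `<=` E)%fset, #|` A| = l & free [seq f u | u <- A]]) <->
  (l <= \dim <<[seq f u | u <- E]>>)%N.
Proof.
split=> [[A [/fsubsetP AE <- freeA]]|].
  rewrite -(size_map f A) -(eqP freeA); apply/dimvS/sub_span => x /mapP[u uA ->].
  by apply/map_f/AE.
have [s [sE frees <-]] := span_subseq_free f E.
rewrite (eqP frees) size_map => /(fset_of_subseq sE)[A [AE Al permA]].
exists A; split=> //; rewrite (perm_free (perm_map f permA)) map_take.
by move: frees; rewrite -{1}(cat_take_drop l (map f s)) => /catl_free.
Qed.

Lemma exists_uniq_fsubset (X : eqType) (f : T -> X) (E : {fset T}) l :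
  (exists A : {fset T}, [/\ (A `<=` E)%fset, #|` A| = l & uniq [seq f u | u <- A]]) <->
  (l <= size (undup [seq f u | u <- E]))%N.
Proof.
split=> [[A [/fsubsetP AE <- uniqA]]|].
  rewrite -(size_map f A) uniq_leq_size// => x /mapP[u uA ->].
  by rewrite mem_undup; apply/map_f/AE.
have [s [sE uniqs eqs]] := uniq_map_subseq f E.
rewrite -(perm_size (uniq_perm uniqs (undup_uniq _) _)); last first.
  by move=> x; rewrite mem_undup.
rewrite size_map => /(fset_of_subseq sE)[A [AE Al permA]].
by exists A; split=> //; rewrite (perm_uniq (perm_map f permA)) map_take take_uniq.
Qed.

End Selection.

Section Lines.
Variables (F : finFieldType) (n : nat).
Local Notation q := #|F|.
Implicit Types (v w : 'rV[F]_n) (W : {vspace 'rV[F]_n}).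

Let q_gt1 : (1 < q)%N. Proof. exact: finNzRing_gt1. Qed.

Lemma card_nonzero W :
  #|[set v : 'rV[F]_n | (v != 0) && (v \in W)]| = (q ^ \dim W - 1)%N.
Proof.
rewrite -card_vspace -(cardsE (mem W)) (cardsD1 0 [set x in mem W]) inE/= mem0v.
rewrite add1n subn1 /=.
by apply: eq_card => v; rewrite !inE; case: eqP.
Qed.

Lemma dim_rV : \dim (fullv : {vspace 'rV[F]_n}) = n.
Proof. by rewrite dimvf /dim/= mul1n. Qed.

Lemma card_rV_nonzero : #|[set v : 'rV[F]_n | v != 0]| = (q ^ n - 1)%N.
Proof.
have := card_nonzero fullv; rewrite dim_rV => <-.
by apply: eq_card => v; rewrite !inE memvf andbT.
Qed.

(* vpick depends only on the subspace, so pt v is a canonical generator of the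
   line through v. *)
Definition pt v : 'rV[F]_n := vpick <[v]>.

Lemma pt_eq0 v : (pt v == 0) = (v == 0).
Proof. by rewrite vpick0 -dimv_eq0 dim_vline; case: (v == 0). Qed.

Lemma vline_pt v : (<[pt v]> = <[v]>)%VS.
Proof.
apply/eqP; rewrite eqEdim -memvE memv_pick/= !dim_vline pt_eq0.
exact: leqnn.
Qed.

Lemma ptK v : pt (pt v) = pt v.
Proof. by rewrite /pt vline_pt. Qed.

Lemma mem_pt W v : (pt v \in W) = (v \in W).
Proof. by rewrite !memvE vline_pt. Qed.

Lemma eq_pt v w : v != 0 -> (pt v == pt w) = (v \in <[w]>%VS).
Proof.
move=> v0; apply/eqP/idP => [vw|vw].
  by rewrite -(vline_pt w) -vw vline_pt memv_line.
rewrite /pt; congr vpick; apply/eqP; rewrite eqEdim -memvE vw/= !dim_vline v0.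
by case: (w == 0).
Qed.

Lemma free_pt v w : v != 0 -> w != 0 -> free [:: v; w] = (pt v != pt w).
Proof. by move=> v0 w0; rewrite free_cons seq1_free w0 andbT span_seq1 eq_pt. Qed.

(** The projective space of [W], each line being represented by its canonical generator. *)
Definition points W : {set 'rV[F]_n} := [set v | [&& v != 0, pt v == v & v \in W]].

(** Scaling is a bijection from pairs of a nonzero scalar and a point of [W] to the nonzero vectors
    of [W]. *)
Lemma card_points W : (#|points W| * (q - 1))%N = (q ^ \dim W - 1)%N.
Proof.
rewrite -card_nonzero -cardsT (cardsD1 0 [set: F]) inE add1n subn1 mulnC -cardsX.
rewrite -(card_in_imset (f := fun x : F * 'rV[F]_n => x.1 *: x.2)).
  apply: eq_card => v; apply/imsetP/idP.
    move=> [[c r]]; rewrite !inE/= andbT => /and4P[c0 r0 _ rW ->].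
    by rewrite scaler_eq0 negb_or c0 r0/= memvZ.
  rewrite !inE => /andP[v0 vW].
  have /vlineP[c vc] : v \in <[pt v]>%VS by rewrite vline_pt memv_line.
  exists (c, pt v) => //; rewrite !inE/= andbT pt_eq0 v0 ptK eqxx mem_pt vW !andbT.
  by apply: contra_neq v0 => c0; rewrite vc c0 scale0r.
move=> [c r] [d s]; rewrite !inE/= !andbT.
move=> /and4P[c0 r0 /eqP rE _] /and4P[d0 s0 /eqP sE _] eq_cd.
have ptZ a v : a != 0 -> pt (a *: v) = pt v.
  move=> a0; case: (eqVneq v 0) => [->|v0]; first by rewrite scaler0.
  by apply/eqP; rewrite eq_pt ?scaler_eq0 ?negb_or ?a0// memvZ// memv_line.
have eq_rs : r = s by rewrite -rE -sE -(ptZ c r)// eq_cd ptZ.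
congr (_, _) => //; apply/eqP; rewrite -subr_eq0; move/eqP: eq_cd.
by rewrite eq_rs -subr_eq0 -scalerBl scaler_eq0 (negPf s0) orbF.
Qed.

Lemma card_pointsE W : #|points W| = ((q ^ \dim W - 1) %/ (q - 1))%N.
Proof. by rewrite -card_points mulnK// subn_gt0. Qed.

Lemma vspace_extension W d : (\dim W <= d <= n)%N ->
  exists2 V : {vspace 'rV[F]_n}, (W <= V)%VS & \dim V = d.
Proof.
case/andP => /subnKC <-; elim: (d - _)%N => [|m IH] dn.
  by exists W; rewrite ?addn0.
have [|V WV dimV] := IH; first by rewrite (leq_trans _ dn)// addnS.
have [v vV] : exists v, v \notin V.
  apply/existsP; apply: contraTT dn => /existsPn VT.
  rewrite addnS -dimV -leqNgt -[X in (X <= _)%N]dim_rV.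
  by apply/dimvS/subvP => v _; move: (VT v); rewrite negbK.
exists (V + <[v]>)%VS; first exact: subv_trans WV (addvSl _ _).
rewrite dimv_disjoint_sum ?dim_vline.
  by rewrite dimV addnS; case: eqP vV => [->|_]; rewrite ?mem0v// addn1.
apply/eqP; rewrite -subv0; apply/subvP => u.
rewrite memv_cap => /andP[uV /vlineP[c uE]].
rewrite memv0 uE; case: (eqVneq c 0) => [->|c0]; first by rewrite scale0r.
by case/negP: vV; rewrite -(scalerK c0 v) memvZ// -uE.
Qed.

Lemma rV_transitive v w : v != 0 -> w != 0 ->
  exists2 h : 'M[F]_n, h \in unitmx & v *m h = w.
Proof.
(* It is enough to reach every nonzero [u] from the first basis vector [pid_mx 1]. The rank
   factorisation of [u] does this once its 1 by 1 column factor is absorbed into the row factor as a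
   scalar. *)
suff H (u : 'rV[F]_n) : u != 0 ->
    exists2 h : 'M[F]_n, h \in unitmx & u = (pid_mx 1 : 'rV[F]_n) *m h.
  move=> /H[g gU ->] /H[h hU ->]; exists (invmx g *m h).
    by rewrite unitmx_mul unitmx_inv gU.
  by rewrite mulmxA mulmxK.
move=> u0; have rk1 : \rank u = 1%N by rewrite rank_rV u0.
have := mulmx_ebase u; rewrite rk1 [col_ebase u]mx11_scalar.
set c := col_ebase u 0 0 => <-; exists (c *: row_ebase u).
  rewrite unitmxE detZ unitrM unitrX -?unitmxE ?row_ebase_unit//.
  by have := col_ebase_unit u; rewrite unitmxE [col_ebase u]mx11_scalar det_scalar1.
by rewrite -scalemxAr mul_scalar_mx -scalemxAl.
Qed.

End Lines.

(** * Averaging over the general linear group *)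

Section Averaging.
Variables (F : finFieldType) (n : nat).
Local Notation q := #|F|.

Definition unitmx_set : {set 'M[F]_n} := [set g | g \in unitmx].

(** Counts the translates of [W], taken as preimages under invertible [g], that contain [v]. *)
Definition hits (W : {vspace 'rV[F]_n}) (v : 'rV[F]_n) : nat :=
  #|[set g in unitmx_set | v *m g \in W]|.

(** If [h] sends [u'] to [u], then left multiplication by [h] injects the matrices counted for [u]
    into those counted for [u']. *)
Lemma hits_const W v w : v != 0 -> w != 0 -> hits W v = hits W w.
Proof.
suff le u u' : u != 0 -> u' != 0 -> (hits W u <= hits W u')%N.
  by move=> v0 w0; apply/eqP; rewrite eqn_leq !le.
move=> u0 u'0; have [h hU <-] := rV_transitive u'0 u0.
rewrite /hits -(card_imset (f := mulmx h)); last exact: (can_inj (mulKmx hU)).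
apply/subset_leq_card/fintype.subsetP => _ /imsetP[g gP ->].
by move: gP; rewrite !inE mulmxA unitmx_mul hU.
Qed.

Lemma dim_preim_mulmx W (g : 'M[F]_n) : g \in unitmx ->
  \dim (linfun (mulmxr g : 'rV[F]_n -> 'rV[F]_n) @^-1: W)%VS = \dim W.
Proof.
move=> gU; set f := linfun _.
have fK v : f (v *m invmx g) = v by rewrite lfunE /= mulmxKV.
have injf : injective f by move=> u v; rewrite !lfunE /= => /(can_inj (mulmxK gU)).
rewrite -[in RHS](@lpreimK _ _ _ f W).
  by rewrite limg_dim_eq// (eqP (_ : lker f == 0%VS)) ?capv0//; apply/lker0P.
by apply/subvP => v _; rewrite -(fK v) memv_img// memvf.
Qed.

Lemma mem_preim_mulmx W (g : 'M[F]_n) (v : 'rV[F]_n) :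
  (v \in (linfun (mulmxr g : 'rV[F]_n -> 'rV[F]_n) @^-1: W)%VS) = (v *m g \in W).
Proof. by rewrite -memv_preim lfunE. Qed.

(** Double counting of the pairs of an invertible [g] and a nonzero [w] with [w *m g] in [W]: every
    [w] contributes the same number, and every [g] contributes the nonzero vectors of a subspace of
    dimension [\dim W]. *)
Lemma hits_card W v : v != 0 ->
  (hits W v * (q ^ n - 1) = #|unitmx_set| * (q ^ \dim W - 1))%N.
Proof.
move=> v0; rewrite mulnC -card_rV_nonzero -sum_nat_const -[RHS]sum_nat_const.
rewrite (eq_bigr (fun w => \sum_(g in unitmx_set) (w *m g \in W))%N); last first.
  move=> w; rewrite inE => w0; rewrite (hits_const W v0 w0) /hits -sum1_card.
  rewrite big_mkcond [RHS]big_mkcond; apply: eq_bigr => g _.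
  by rewrite !inE; case: (g \in unitmx); case: (_ \in W).
rewrite exchange_big; apply: eq_bigr => g; rewrite inE => gU.
rewrite -(dim_preim_mulmx W gU) -card_nonzero -sum1_card.
rewrite big_mkcond [RHS]big_mkcond; apply: eq_bigr => w _.
by rewrite !inE mem_preim_mulmx; case: (w != 0); case: (_ \in W).
Qed.

(* The translates of a fixed d-dimensional subspace under the general linear
   group cover every nonzero vector equally often. *)
Lemma averaging_bound (T : choiceType) (f : T -> 'rV[F]_n) (A : {fset T}) d b :
  (d <= n)%N -> {in A, forall u, f u != 0} ->
  (forall W, \dim W = d -> (count (fun u => f u \in W) A <= b)%N) ->
  (#|` A| * (q ^ d - 1) <= b * (q ^ n - 1))%N.
Proof.
move=> dn f0 Ab; have [|W _ dimW] := @vspace_extension F n 0%VS d.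
  by rewrite dimv0 dn.
have G0 : (0 < #|unitmx_set|)%N.
  by apply/card_gt0P; exists 1%:M; rewrite inE unitmx1.
(* Counted by [g] instead of by [u]: each translate of [W] has dimension [d], so it contains at most
   [b] of the vectors. *)
have sumG : (\sum_(u <- A) hits W (f u) <= #|unitmx_set| * b)%N.
  rewrite (eq_bigr (fun u => \sum_(g in unitmx_set) (f u *m g \in W))%N); last first.
    move=> u _; rewrite /hits -sum1_card big_mkcond [RHS]big_mkcond.
    by apply: eq_bigr => g _; rewrite !inE; case: (g \in unitmx); case: (_ \in W).
  rewrite exchange_big -sum_nat_const; apply: leq_sum => g; rewrite inE => gU.
  apply: leq_trans (Ab (linfun (mulmxr g) @^-1: W)%VS _).
    rewrite -sum1_count [leqRHS]big_mkcond; apply: leq_sum => u _.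
    by rewrite mem_preim_mulmx; case: (_ \in W).
  by rewrite dim_preim_mulmx.
rewrite -(leq_pmul2l G0) [leqRHS]mulnA mulnCA -dimW.
apply: leq_trans (leq_mul sumG (leqnn _)).
rewrite big_distrl/= big_seq (eq_bigr (fun=> #|unitmx_set| * (q ^ \dim W - 1))%N).
  by rewrite -big_seq big_const_seq count_predT iter_addn_0 mulnC.
by move=> u uA; rewrite hits_card// f0.
Qed.

End Averaging.

(** * The families as weight conditions *)

Lemma uniq_map_injP (T X : eqType) (f : T -> X) (s : seq T) : uniq s ->
  reflect {in s &, injective f} (uniq [seq f u | u <- s]).
Proof.
move=> uniq_s; apply: (iffP idP) => [|/map_inj_in_uniq ->//].
elim: s uniq_s => [|x s IH] //= /andP[_ /IH{}IH] /andP[fx /IH{}IH] u v.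
rewrite !inE => /predU1P[->|us] /predU1P[->|vs] //; last exact: IH.
- by move=> eqf; rewrite eqf map_f in fx.
- by move=> eqf; rewrite -eqf map_f in fx.
Qed.

Lemma fset_set_count (T : choiceType) (P : pred T) (A : {fset T}) k :
  (k <= count P A)%N -> exists E : {fset T},
    [/\ (E `<=` A)%fset, #|` E| = k & {in E, forall u, P u}].
Proof.
rewrite -size_filter => /(fset_of_subseq (filter_subseq P A))[E [EA Ek permE]].
exists E; split=> // u; rewrite -[u \in E]/(u \in (E : seq T)) (perm_mem permE).
by move=> /mem_take; rewrite mem_filter => /andP[].
Qed.

(** An infinite member would contain [B.+1] elements, so all members are finite of bounded size. The
    maximum therefore exists, and [max_size] is not its default value. *)
Lemma max_sizeP (T : choiceType) (P : set (set T)) B : P set0 ->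
  (forall S, P S -> forall E : {fset T}, [set` E] `<=` S -> (#|` E| <= B)%N)%classic ->
  [/\ is_max_size P (max_size P),
      forall A : {fset T}, P [set` A]%classic -> (#|` A| <= max_size P)%N &
      exists2 A : {fset T}, P [set` A]%classic & #|` A| = max_size P].
Proof.
move=> P0 PB.
have finP S : P S -> exists A : {fset T}, S = [set` A]%classic.
  move=> PS; apply/finite_fsetP; apply: contrapT.
  move=> /infinite_set_fsetP/(_ B.+1)[E ES].
  by rewrite ltnNge (PB _ PS).
pose Q m := `[< exists2 A : {fset T}, P [set` A]%classic & #|` A| = m >].
have exQ : exists m, Q m.
  exists 0%N; apply/asboolP; exists fset0; rewrite ?cardfs0//.
  by have -> : [set` fset0 : {fset T}]%classic = set0 by apply/seteqP; split.
have ubQ m : Q m -> (m <= B)%N.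
  by move=> /asboolP[A PA <-]; exact: PB PA _ _.
have [m /asboolP[A PA Am] maxm] := ex_maxnP exQ ubQ.
have cardQ (A' : {fset T}) : P [set` A']%classic -> (#|` A'| <= m)%N.
  by move=> PA'; apply: maxm; apply/asboolP; exists A'.
have maxP : is_max_size P m.
  split; first by exists [set` A]%classic => //; apply/card_eq_fsetP.
  move=> S PS; have [A' SA'] := finP S PS; rewrite SA' in PS *.
  have/card_eq_fsetP/card_le_eql -> : #|` A'| = #|` A'| by [].
  by rewrite card_le_II cardQ.
have [[S PS SM] maxS] : is_max_size P (max_size P).
  by apply: (@xgetPex _ 0%N [set m | is_max_size P m]%classic); exists m.
split=> [|A' /maxS|]; first by split=> //; exists S.
  have/card_eq_fsetP/card_le_eql -> : #|` A'| = #|` A'| by [].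
  by rewrite card_le_II.
have [A' SA'] := finP S PS; rewrite SA' in PS SM.
by exists A' => //; apply/card_eq_fsetP.
Qed.

Section Families.
Variables (R : realType) (K : fieldType) (nu : K -> int) (F : finFieldType).
Variable res : K -> F.
Hypotheses (nuP : discrete_valuation nu) (resP : residue_map nu res).
Variable n : nat.
Hypothesis n_gt0 : (0 < n)%N.

Local Notation q := #|F|.
Local Notation rho := (@red K F res n).
Local Notation unitv := (@unit_vectors R K q nu n).
Local Notation orth := (norm_orthogonal R q nu).
Local Notation weakly_orth := (norm_weakly_orthogonal R q nu).
Local Notation rank E := (\dim <<[seq rho u | u <- enum_fset E]>>%VS).
Implicit Types (A E : {fset 'rV[K]_n}) (W : {vspace 'rV[F]_n}).

Let q_gt1 : (1 < q)%N. Proof. exact: finNzRing_gt1. Qed.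

Lemma red_unit_neq0 u : unitv u -> rho u != 0.
Proof. by case/(unit_vectorsP R resP). Qed.

Lemma norm_orthogonal2 u v : unitv u -> unitv v -> u != v ->
  orth [fset u; v]%fset <-> pt (rho u) != pt (rho v).
Proof.
move=> u1 v1 uv; rewrite (norm_orthogonalP nuP resP); last first.
  by move=> w; rewrite !inE => /orP[]/eqP->.
rewrite -free_pt ?red_unit_neq0//.
have /(perm_map rho)/perm_free -> // : perm_eq (enum_fset [fset u; v]%fset) [:: u; v].
apply: uniq_perm; rewrite ?fset_uniq//= ?inE ?uv// => w.
by rewrite -[w \in enum_fset _]/(w \in [fset u; v]%fset) !inE.
Qed.

Lemma weakly_orthogonalP A : {in A, forall u, unitv u} ->
  weakly_orth A <-> uniq [seq pt (rho u) | u <- A].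
Proof.
move=> A1; split=> [[_ H]|/(uniq_map_injP _ (fset_uniq A)) inj].
  apply/(uniq_map_injP _ (fset_uniq A)) => u v uA vA eq_uv.
  apply/eqP; apply: contraT => uv; have := H _ _ uA vA uv.
  by move/(norm_orthogonal2 (A1 u uA) (A1 v vA) uv)/eqP.
split=> [u uA|u v uA vA uv].
  by apply: contra_neq (red_unit_neq0 (A1 u uA)) => ->; exact: (red0 resP).
apply/(norm_orthogonal2 (A1 u uA) (A1 v vA) uv).
by apply: contraNneq uv => /inj ->.
Qed.

(** The projective points over which [E] lies. Weak orthogonality sees only their number,
    orthogonality sees the dimension of their span. *)
Definition labels E : {set 'rV[F]_n} := [set p in [seq pt (rho u) | u <- E]].

Lemma labelsP E p : reflect (exists2 u, u \in E & p = pt (rho u)) (p \in labels E).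
Proof. by rewrite inE; exact: mapP. Qed.

Lemma mem_labels E u : u \in E -> pt (rho u) \in labels E.
Proof. by move=> uE; apply/labelsP; exists u. Qed.

Lemma labelsU1 u E : labels (u |` E)%fset = pt (rho u) |: labels E.
Proof.
apply/setP => p; rewrite in_setU1; apply/labelsP/idP.
  move=> [v /fset1UP[->|vE] ->]; first by rewrite eqxx.
  by rewrite mem_labels ?orbT.
case/predU1P => [->|/labelsP[v vE ->]]; first by exists u => //; rewrite !inE eqxx.
by exists v => //; rewrite !inE vE orbT.
Qed.

Lemma card_labels E : #|labels E| = size (undup [seq pt (rho u) | u <- E]).
Proof.
rewrite -(card_uniqP (undup_uniq _)); apply: eq_card => p.
by rewrite inE mem_undup.
Qed.

Lemma rank_le_dim E W : {in E, forall u, rho u \in W} -> (rank E <= \dim W)%N.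
Proof. by move=> EW; apply/dimvS/span_subvP => _ /mapP[u uE ->]; exact: EW. Qed.

Lemma rank_le_labels E : (rank E <= #|labels E|)%N.
Proof.
rewrite card_labels; set s := undup _; apply: leq_trans (dim_span s).
apply: rank_le_dim => u uE; rewrite -mem_pt; apply: memv_span.
by rewrite mem_undup; apply: map_f.
Qed.

Variables k l : nat.
Hypotheses (l_ge2 : (2 <= l)%N) (le_lk : (l <= k)%N).

Let P_Theta := Theta_family R q nu n k l.
Let P_Delta := Delta_family R q nu n k l.

Lemma Theta_familyP A : P_Theta [set` A]%classic <->
  {in A, forall u, unitv u} /\
  (forall E, (E `<=` A)%fset -> #|` E| = k -> (l <= rank E)%N).
Proof.
split=> [[A1 [_ AP]]|[A1 AP]]; split=> //.
  move=> E /fsubsetP EA Ek; rewrite -exists_free_fsubset.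
  have [B [BE Bl /norm_orthogonalP freeB]] := AP E EA Ek.
  exists B; split=> //; apply: (freeB _ nuP resP) => u /(fsubsetP BE) uE.
  exact/A1/EA.
split=> [u /A1/red_unit_neq0|E EA Ek].
  by apply: contra_neq => ->; exact: (red0 resP).
have EA' : (E `<=` A)%fset by apply/fsubsetP.
have [B [BE Bl freeB]] := (exists_free_fsubset rho E l).2 (AP E EA' Ek).
exists B; split=> //; apply/(norm_orthogonalP nuP resP) => // u /(fsubsetP BE) uE.
exact/A1/EA.
Qed.

Lemma Delta_familyP A : P_Delta [set` A]%classic <->
  {in A, forall u, unitv u} /\
  (forall E, (E `<=` A)%fset -> #|` E| = k -> (l <= #|labels E|)%N).
Proof.
split=> [[A1 [_ AP]]|[A1 AP]]; split=> //.
  move=> E /fsubsetP EA Ek; rewrite card_labels -exists_uniq_fsubset.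
  have [B [BE Bl /weakly_orthogonalP uB]] := AP E EA Ek.
  exists B; split=> //; apply: uB => u /(fsubsetP BE) uE.
  exact/A1/EA.
split=> [u /A1/red_unit_neq0|E EA Ek].
  by apply: contra_neq => ->; exact: (red0 resP).
have EA' : (E `<=` A)%fset by apply/fsubsetP.
have := AP E EA' Ek; rewrite card_labels -exists_uniq_fsubset => -[B [BE Bl uB]].
exists B; split=> //; apply/weakly_orthogonalP => // u /(fsubsetP BE) uE.
exact/A1/EA.
Qed.

Lemma Theta_family_sub_Delta A : P_Theta [set` A]%classic -> P_Delta [set` A]%classic.
Proof.
move=> /Theta_familyP[A1 AP]; apply/Delta_familyP; split=> // E EA Ek.
exact: leq_trans (AP E EA Ek) (rank_le_labels E).
Qed.

(** A crude bound that secures the existence of both maxima: [k] vectors with the same reduction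
    would have a single label, fewer than [l]. *)
Lemma Delta_card_bound A : P_Delta [set` A]%classic -> (#|` A| <= q ^ n * k)%N.
Proof.
move=> /Delta_familyP[A1 AP].
have -> : #|` A| = (\sum_(x : 'rV[F]_n) count (fun u => rho u == x) A)%N.
  under eq_bigr do rewrite -sum1_count big_mkcond.
  rewrite exchange_big/= -[LHS]sum1_size; apply: eq_bigr => u _.
  by rewrite -big_mkcond (big_pred1 (rho u)).
have card_rV : #|{: 'rV[F]_n}| = (q ^ n)%N by rewrite card_mx mul1n.
rewrite -card_rV -sum_nat_const; apply: leq_sum => x _.
rewrite leqNgt; apply/negP => /ltnW/fset_set_count[E [EA Ek /= Ex]].
have := AP E EA Ek; rewrite leqNgt => /negP; apply.
apply: leq_trans l_ge2; rewrite ltnS.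
apply: (@leq_trans #|[set pt x]|); last by rewrite cards1.
apply/subset_leq_card/fintype.subsetP => _ /labelsP[u /Ex/eqP-> ->].
by rewrite inE.
Qed.

Lemma family_hereditary (o : {fset 'rV[K]_n} -> Prop) (S : set 'rV[K]_n) A :
  (S `<=` unitv /\ kl_set o k l S -> [set` A] `<=` S ->
   [set` A] `<=` unitv /\ kl_set o k l [set` A])%classic.
Proof.
move=> [S1 [S0 SP]] AS; split; first exact: subset_trans AS S1.
split; first exact: subset_trans AS S0.
by move=> E EA; apply: SP; exact: subset_trans EA AS.
Qed.

Lemma family_empty (o : {fset 'rV[K]_n} -> Prop) :
  (set0 `<=` unitv /\ kl_set o k l set0)%classic.
Proof.
split=> //; split=> // E E0 Ek.
have : (0 < #|` E|)%N by rewrite Ek (leq_trans _ le_lk)// (leq_trans _ l_ge2).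
by rewrite cardfs_gt0 => /fset0Pn[u /E0].
Qed.

Lemma Theta_max :
  [/\ is_max_size P_Theta (Theta R q nu n k l),
      forall A, P_Theta [set` A]%classic -> (#|` A| <= Theta R q nu n k l)%N &
      exists2 A, P_Theta [set` A]%classic & #|` A| = Theta R q nu n k l].
Proof.
apply: (@max_sizeP _ _ (q ^ n * k)); first exact: family_empty.
by move=> S PS E /(family_hereditary PS)/Theta_family_sub_Delta/Delta_card_bound.
Qed.

Lemma Delta_max :
  [/\ is_max_size P_Delta (Delta R q nu n k l),
      forall A, P_Delta [set` A]%classic -> (#|` A| <= Delta R q nu n k l)%N &
      exists2 A, P_Delta [set` A]%classic & #|` A| = Delta R q nu n k l].
Proof.
apply: (@max_sizeP _ _ (q ^ n * k)); first exact: family_empty.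
by move=> S PS E /(family_hereditary PS)/Delta_card_bound.
Qed.

(** Any [k] vectors with reductions in [W] would have rank at most [\dim W], below [l]. *)
Lemma Theta_family_count A W : P_Theta [set` A]%classic -> (\dim W < l)%N ->
  (count (fun u => rho u \in W) A < k)%N.
Proof.
move=> /Theta_familyP[_ AP] dimW; rewrite ltnNge.
apply/negP => /fset_set_count[E [EA Ek EW]].
by move: dimW; rewrite ltnNge (leq_trans (AP E EA Ek))// rank_le_dim.
Qed.

Lemma Theta_upper : (l <= n + 1)%N ->
  (Theta R q nu n k l * (q ^ (l - 1) - 1) <= (k - 1) * (q ^ n - 1))%N.
Proof.
move=> ln; have [_ _ [A AP <-]] := Theta_max.
have l0 : (0 < l)%N by rewrite (leq_trans _ l_ge2).
(* Subspaces of dimension [l - 1] are averaged, with [b = k - 1]; they exist because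
   [l <= n + 1]. *)
apply: (averaging_bound (f := rho)); first by rewrite leq_subLR addnC.
  by have [A1 _] := (Theta_familyP A).1 AP; move=> u /A1/red_unit_neq0.
move=> W dimW; have := @Theta_family_count A W AP.
rewrite dimW subn1 prednK// => /(_ (leqnn _)) lt_k.
by rewrite subn1 -ltnS prednK// (leq_trans l0).
Qed.

(** [D] encodes a weight: the pairs over [v] are the copies of [v], realised by distinct lifts. The
    second hypothesis bounds the weight of small subspaces. *)
Lemma Theta_lower m (D : {set 'rV[F]_n * 'I_m}) :
  {in D, forall x, x.1 != 0} ->
  (forall W, \dim W < l -> #|[set x in D | x.1 \in W]| < k)%N ->
  (#|D| <= Theta R q nu n k l)%N.
Proof.
move=> D0 DW; have [_ max _] := Theta_max.
have [lift [redK lift1 lift_inj]] := lift_exists R nuP resP n_gt0.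
pose f (x : 'rV[F]_n * 'I_m) := lift x.1 x.2.
have f_inj : injective f by move=> [v i] [w j] /lift_inj[/= -> /val_inj ->].
pose A := [fset x in [seq f x | x <- enum D]]%fset.
have -> : #|D| = #|` A|.
  by rewrite card_fseq undup_id ?map_inj_uniq ?enum_uniq// size_map cardE.
apply/max/Theta_familyP; split=> [u|E /fsubsetP EA Ek].
  by rewrite inE => /mapP[x]; rewrite mem_enum => /D0 x0 ->; exact: lift1.
(* If the reductions of [E] span less than dimension [l], their span has weight below [k], yet it
   receives all [k] elements of [E]. *)
rewrite leqNgt; apply/negP => /DW; rewrite ltnNge => /negP; apply.
rewrite -{1}Ek cardE -(size_map f); apply: uniq_leq_size; first exact: fset_uniq.
move=> u uE; have := EA u uE; rewrite inE => /mapP[x]; rewrite mem_enum => xD ux.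
rewrite ux map_f// mem_enum inE xD/= -(redK x.1 x.2) -[lift _ _]ux.
by apply/memv_span/map_f.
Qed.

End Families.

(** * Constructions *)

(** In geometric terms, a space of dimension [m >= 2] has more than [m] projective points. *)
Lemma expn_sub1_bound q m : (1 < q)%N -> (2 <= m)%N -> (m.+1 * (q - 1) <= q ^ m - 1)%N.
Proof.
move=> q1; case: m => [|[|m]]// _; elim: m => [|m IH].
  by rewrite expnS expn1; nia.
have pos : (0 < q ^ m.+2)%N by rewrite expn_gt0 (ltnW q1).
by rewrite expnS; nia.
Qed.

Section Maxima.
Variables (R : realType) (K : fieldType) (nu : K -> int) (F : finFieldType).
Variable res : K -> F.
Hypotheses (nuP : discrete_valuation nu) (resP : residue_map nu res).
Variable n : nat.
Hypothesis n_gt0 : (0 < n)%N.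
Variables k l : nat.
Hypotheses (l_ge2 : (2 <= l)%N) (le_lk : (l <= k)%N).

Local Notation q := #|F|.
Local Notation rho := (@red K F res n).
Local Notation rank E := (\dim <<[seq rho u | u <- enum_fset E]>>%VS).
Local Notation labels := (labels res).
Local Notation P_Theta := (Theta_family R q nu n k l).
Local Notation P_Delta := (Delta_family R q nu n k l).
Local Notation Theta := (Theta R q nu n k l).
Local Notation Delta := (Delta R q nu n k l).
Implicit Types (A E : {fset 'rV[K]_n}) (W : {vspace 'rV[F]_n}).

Let q_gt1 : (1 < q)%N. Proof. exact: finNzRing_gt1. Qed.
Let l_gt0 : (0 < l)%N. Proof. exact: ltnW. Qed.
Let k_gt0 : (0 < k)%N. Proof. exact: leq_trans le_lk. Qed.

Lemma exists_nonzero_rV : exists v : 'rV[F]_n, v != 0.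
Proof.
exists (const_mx 1); apply/eqP => /rowP/(_ (Ordinal n_gt0)).
by rewrite !mxE => /eqP; rewrite oner_eq0.
Qed.

Lemma expn_dim_sub1 W : (\dim W < l)%N -> (q ^ \dim W - 1 <= q ^ (l - 1) - 1)%N.
Proof. by move=> Wl; rewrite leq_sub2r// leq_exp2l// subn1 -ltnS prednK. Qed.

(** Every projective point gets weight [t]. The floor is the largest [t] for which the points of an
    [(l - 1)]-dimensional space weigh at most [k - 1] in total. *)
Lemma Theta_ge_points :
  ((k - 1) * (q - 1) %/ (q ^ (l - 1) - 1) * ((q ^ n - 1) %/ (q - 1)) <= Theta)%N.
Proof.
set t := (_ %/ (q ^ _ - 1))%N.
have -> : (t * ((q ^ n - 1) %/ (q - 1)))%N =
    #|finset.setX (points (fullv : {vspace 'rV[F]_n})) [set: 'I_t]|.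
  by rewrite cardsX card_pointsE dim_rV cardsT card_ord mulnC.
apply: (Theta_lower R nuP resP) => //.
  by move=> x; rewrite !inE => /andP[/and3P[]].
move=> W /expn_dim_sub1 dimW.
have -> : [set x in finset.setX (points fullv) [set: 'I_t] | x.1 \in W] =
    finset.setX (points W) [set: 'I_t].
  by apply/setP => x; rewrite !inE memvf !andbT -andbA.
rewrite cardsX cardsT card_ord.
have tq : (t * (q ^ (l - 1) - 1) <= (k - 1) * (q - 1))%N by exact: leq_divM.
rewrite -[leqRHS](prednK k_gt0) ltnS -subn1 -(@leq_pmul2r (q - 1)) ?subn_gt0//.
by rewrite mulnAC card_points (leq_trans _ tq)// mulnC leq_mul2l dimW orbT.
Qed.

Lemma Theta_ge_card_rV : (q ^ (l - 1) < k)%N -> (q ^ n <= Theta)%N.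
Proof.
move=> qk; have [v0 v0_neq0] := exists_nonzero_rV.
(* Weight 1 on the nonzero vectors satisfying [P], plus a second copy of [v0]. The instance [mem W]
   keeps this copy even if [v0] lies outside [W], so it only bounds the part over [W]; at most
   [q ^ (l - 1)] elements remain. *)
pose D (P : pred 'rV[F]_n) :=
  (v0, 1 : 'I_2) |: finset.setX [set v | (v != 0) && P v] [set 0 : 'I_2].
have cardD P : #|D P| = #|[set v | (v != 0) && P v]|.+1.
  by rewrite cardsU1 !inE andbF cardsX cards1 muln1.
have -> : (q ^ n)%N = #|D xpredT|.
  rewrite cardD; under [in RHS]eq_finset do rewrite andbT.
  by rewrite card_rV_nonzero subn1 prednK// expn_gt0 (ltnW q_gt1).
apply: (Theta_lower R nuP resP) => //.
  by move=> x; rewrite !inE => /predU1P[->//|/andP[/andP[]]].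
move=> W /expn_dim_sub1 dimW; apply: (@leq_ltn_trans #|D (mem W)|).
  apply/subset_leq_card/fintype.subsetP => x; rewrite !inE.
  by case/andP => /predU1P[->|/andP[/andP[-> _] ->] ->]; rewrite ?eqxx ?orbT.
rewrite cardD card_nonzero; apply: leq_ltn_trans qk.
by apply: leq_ltn_trans dimW _; rewrite subn1 prednK// expn_gt0 (ltnW q_gt1).
Qed.

Lemma Ind_le : (Ind F n k l <= q ^ n - 1)%N.
Proof.
apply/bigmax_leqP => S /andP[S0 _]; rewrite -card_rV_nonzero.
apply/subset_leq_card/fintype.subsetP => v vS; rewrite inE.
by apply: contraNneq S0 => <-.
Qed.

Lemma Delta_ge_k : (l <= #|points (fullv : {vspace 'rV[F]_n})|)%N -> (k <= Delta)%N.
Proof.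
move=> lP; have [_ max _] := Delta_max R nuP resP n l_ge2 le_lk.
have [lift [redK lift1 lift_inj]] := lift_exists R nuP resP n_gt0.
pose s := enum (points (fullv : {vspace 'rV[F]_n})).
(* The first [l - 1] vectors lie over distinct points and all others over the next one. The only
   subset of size [k] is then the whole set, with [l] labels. *)
pose f i := lift (nth 0 s (minn i (l - 1))) i.
have f_inj : injective f by move=> i j /lift_inj[].
pose A := [fset x in [seq f i | i <- iota 0 k]]%fset.
have Ak : #|` A| = k.
  by rewrite card_fseq undup_id ?map_inj_uniq ?iota_uniq// size_map size_iota.
have nth_points i : nth 0 s (minn i (l - 1)) \in points fullv.
  rewrite -mem_enum mem_nth// -cardE (leq_ltn_trans (geq_minr _ _))//.
  by rewrite (leq_trans _ lP)// subn1 prednK.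
rewrite -{1}Ak; apply/max/(Delta_familyP R nuP resP); split=> [u|E EA Ek].
  rewrite inE => /mapP[i _ ->]; apply: lift1.
  by have := nth_points i; rewrite inE => /andP[].
have -> : E = A by apply/eqP; rewrite eqEfcard EA Ak Ek /=.
apply: (@leq_trans (size (take l s))); first by rewrite size_takel -?cardE.
rewrite cardE; apply: uniq_leq_size; first by rewrite take_uniq ?enum_uniq.
move=> p /(nthP 0)[i]; rewrite size_takel -?cardE// => il <-.
rewrite nth_take// mem_enum.
have minE : minn i (l - 1) = i by apply/minn_idPl; rewrite subn1 -ltnS prednK.
have := nth_points i; rewrite minE inE => /and3P[_ /eqP ptE _].
rewrite -ptE -[nth _ _ _](redK _ i); apply: mem_labels.
by rewrite inE; apply/mapP; exists i; rewrite ?mem_iota ?(leq_trans il)// /f minE.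
Qed.

(** A violating [E] must contain [x], as otherwise it lies in [A] and has rank at least [l].
    Exchanging [x] for [y] gives [k] vectors of [A] of rank below [l], a contradiction. *)
Lemma Delta_familyU1 A x : P_Theta [set` A]%classic -> unit_vectors R q nu x ->
  (forall E, (E `<=` x |` A)%fset -> x \in E -> #|` E| = k -> (#|labels E| < l)%N ->
     exists y, [/\ y \in A, y \notin E & (rank (y |` (E `\ x))%fset < l)%N]) ->
  P_Delta [set` (x |` A)%fset]%classic.
Proof.
move=> /(Theta_familyP R nuP resP)[A1 AP] x1 H.
apply/(Delta_familyP R nuP resP); split=> [u /fset1UP[->//|/A1//]|E EA Ek].
have EAx u : u \in E -> u != x -> u \in A.
  by move=> /(fsubsetP EA) /fset1UP[->|//]; rewrite eqxx.
have [xE|xE] := boolP (x \in E); last first.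
  apply: leq_trans (rank_le_labels res E); apply: AP => //; apply/fsubsetP => u uE.
  by apply: EAx => //; apply: contraNneq xE => <-.
rewrite leqNgt; apply/negP => /(H E EA xE Ek)[y [yA yE]].
rewrite ltnNge => /negP; apply.
apply: AP.
  by apply/fsubsetP => u /fset1UP[->//|/fsetD1P[ux uE]]; exact: EAx.
by rewrite cardfsU1 in_fsetD1 (negPf yE) andbF /= -Ek (cardfsD1 x E) xE.
Qed.

(** A largest member [A] of the first family either has fewer than [k] elements, or admits one more
    vector within the second family. *)
Lemma Theta_lt_Delta : (3 <= l)%N -> (l <= #|points (fullv : {vspace 'rV[F]_n})|)%N ->
  (Theta < Delta)%N.
Proof.
move=> l_ge3 lP; have [_ max _] := Delta_max R nuP resP n l_ge2 le_lk.
have [_ _ [A AP <-]] := Theta_max R nuP resP n l_ge2 le_lk.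
have [Ak|kA] := ltnP #|` A| k; first exact: leq_trans Ak (Delta_ge_k lP).
have [A1 Arank] := (Theta_familyP R nuP resP k l A).1 AP.
have ln : (l <= n)%N.
  have [E EA Ek] := exists_fsubset kA.
  by rewrite (leq_trans (Arank E EA Ek))// (leq_trans (dimvS (subvf _)))// dim_rV.
have exchange E x : #|` E| = k -> x \in E -> x \notin A ->
    exists2 y, y \in A & y \notin E.
  move=> Ek xE xA; apply: contrapT => AE.
  have /fsubset_leq_card : (A `<=` E `\ x)%fset.
    apply/fsubsetP => y yA; rewrite in_fsetD1 (contraNneq _ xA) => [|<-//].
    by apply: contrapT => /negP yE; apply: AE; exists y.
  by move: kA; rewrite -Ek (cardfsD1 x) xE add1n; lia.
suff [x [x1 xA xP]] : exists x, [/\ unit_vectors R q nu x, x \notin A &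
    P_Delta [set` (x |` A)%fset]%classic].
  by have := max _ xP; rewrite cardfsU1 xA.
have [lift [redK lift1 lift_inj]] := lift_exists R nuP resP n_gt0.
(* If [A] misses the point [p], add a vector over [p]: exchanging it for any [y] of [A] removes the
   label [p] and adds at most one. *)
have [/existsP[p /andP[pF pA]]|/existsPn hit] :=
    boolP [exists p, (p \in points fullv) && (p \notin labels A)].
  move: pF; rewrite inE => /and3P[p0 /eqP ptE _].
  have xA : lift p 0%N \notin A.
    by apply: contra pA => /(mem_labels res); rewrite redK ptE.
  exists (lift p 0%N); split=> //; first exact: lift1.
  apply: Delta_familyU1 => // [|E /fsubsetP EA xE Ek]; first exact: lift1.
  have [y yA yE] := exchange E _ Ek xE xA.
  rewrite -{1}(fsetD1K xE) labelsU1 redK ptE cardsU1.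
  have -> : p \notin labels (E `\ lift p 0%N)%fset.
    apply: contra pA => /labelsP[u /fsetD1P[ux /EA]].
    by rewrite in_fset1U (negPf ux) => uA ->; exact: mem_labels.
  move=> El; exists y; split=> //.
  apply: leq_ltn_trans (rank_le_labels res _) _; rewrite labelsU1.
  by apply: leq_ltn_trans El; rewrite cardsU1 leq_add2r; exact: leq_b1.
have [v0 v0_neq0] := exists_nonzero_rV.
(* Now [A] meets every point, and any further vector will do; one exists because the fibre over [v0]
   is infinite. *)
have [i xA] : exists i, lift v0 i \notin A.
  apply: contrapT => /forallNP notA.
  have : (size [seq lift v0 i | i <- iota 0 #|` A|.+1] <= size A)%N.
    apply: uniq_leq_size => [|_ /mapP[i _ ->]]; last exact/negPn/negP.
    by rewrite map_inj_uniq ?iota_uniq// => i j /lift_inj[].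
  by rewrite size_map size_iota ltnn.
exists (lift v0 i); split=> //; first exact: lift1.
apply: Delta_familyU1 => // [|E EA xE Ek El]; first exact: lift1.
have [|W /subvP EW dimW] := @vspace_extension F n <<[seq rho u | u <- E]>>%VS (l - 1).
  rewrite (leq_trans (leq_subr _ _) ln) andbT subn1 -ltnS prednK//.
  exact: leq_ltn_trans (rank_le_labels res E) El.
(* As [l - 1 >= 2], the space [W] has at least [l] points, more than [E] has labels. A vector of [A]
   over a missed point is outside [E] and keeps the span inside [W]. *)
have /subsetPn[p pW pE] : ~~ (points W \subset labels E).
  apply: contraL El => /subset_leq_card le_card; rewrite -leqNgt.
  apply: leq_trans le_card; rewrite -(@leq_pmul2r (q - 1)) ?subn_gt0//.
  rewrite card_points dimW -[l in (l * _)%N](prednK l_gt0) -subn1.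
  by apply: expn_sub1_bound => //; rewrite subn1 -ltnS prednK.
have : p \in labels A.
  have := hit p; rewrite negb_and negbK; move: pW; rewrite !inE memvf andbT.
  by case/and3P => -> ->.
case/labelsP => y yA py; exists y; split=> //.
  by apply: contra pE => yE; rewrite py mem_labels.
apply: (@leq_ltn_trans (\dim W)); last by rewrite dimW subn1 prednK.
apply: rank_le_dim => u /fset1UP[->|/fsetD1P[_ uE]].
  by move: pW; rewrite py inE mem_pt => /and3P[].
by apply: EW; apply/memv_span/map_f.
Qed.

Lemma Theta_family2 : l = 2%N -> P_Theta = P_Delta.
Proof.
have orth2 A : #|` A| = 2%N ->
    norm_orthogonal R q nu A <-> norm_weakly_orthogonal R q nu A.
  move=> A2; have [u [v [uv ->]]] : exists u v, u != v /\ A = [fset u; v]%fset.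
    have mem_enum u : (u \in A) = (u \in enum_fset A) by [].
    case: (enum_fset A) A2 (fset_uniq A) mem_enum => [|u [|v []]]//= _.
    rewrite inE andbT => uv memA; exists u, v; split=> //.
    by apply/fsetP => w; rewrite memA !inE.
  split=> [[nz o]|[nz o]]; last by apply: o; rewrite ?inE ?eqxx ?orbT.
  split=> // x y; rewrite !inE => /orP[]/eqP-> /orP[]/eqP->; rewrite ?eqxx//.
  by rewrite fsetUC.
move=> l2; apply/seteqP; split=> S [S1 [S0 SP]]; split=> //; split=> // E ES Ek.
  have [A [AE Al oA]] := SP E ES Ek; exists A; split=> //.
  by apply/orth2; rewrite // Al l2.
have [A [AE Al oA]] := SP E ES Ek; exists A; split=> //.
by apply/orth2; rewrite // Al l2.
Qed.

End Maxima.

(** * Convergence and floor arithmetic *)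

Lemma cvg_natr_ratio (R : realType) (u : nat -> nat) (a b c m : nat) : (0 < b)%N ->
  (forall j, (m <= j)%N -> (u j * b <= j * a <= u j * b + c)%N) ->
  ((fun j => (u j)%:R / j%:R : R) @ \oo --> (a%:R / b%:R : R))%classic.
Proof.
move=> b0 ub; apply/cvgrPdist_le => e e0; near=> j.
have /andP[le1 le2] : (u j * b <= j * a <= u j * b + c)%N.
  by apply: ub; near: j; exact: nbhs_infty_ge.
have bR : 0 < b%:R :> R by rewrite ltr0n.
have j0 : 0 < j%:R :> R by near: j; exact: nbhs_infty_gtr.
(* The error lies between 0 and [c / (b * j)], which is at most [e] from here on. *)
have cj : c%:R / (b%:R * e) <= j%:R by near: j; exact: nbhs_infty_ger.
have -> : a%:R / b%:R - (u j)%:R / j%:R =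
    (j%:R * a%:R - (u j)%:R * b%:R) / (b%:R * j%:R) :> R.
  by field; rewrite !gt_eqF.
rewrite -!natrM ger0_norm; last by rewrite divr_ge0 ?mulr_ge0 ?subr_ge0 ?ler_nat.
have bj0 : 0 < (b * j)%:R :> R by rewrite natrM mulr_gt0.
rewrite ler_pdivrMr// lerBlDr.
move: cj; rewrite ler_pdivrMr ?mulr_gt0// => cj.
rewrite (@le_trans _ _ (u j * b + c)%:R) ?ler_nat// natrD addrC lerD2r.
suff -> : e * (b * j)%:R = j%:R * (b%:R * e) by [].
by rewrite natrM; ring.
Unshelve. all: by end_near.
Qed.

Lemma dvdn_sub1_expn_sub1 q m : (q - 1 %| q ^ m - 1)%N.
Proof. by rewrite !subn1 dvdn_pred_predX. Qed.

Lemma expn_sub1_gt0 q m : (1 < q)%N -> (0 < m)%N -> (0 < q ^ m - 1)%N.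
Proof. by move=> q1 m0; rewrite subn_gt0 -(exp1n m) ltn_exp2r. Qed.

(** The floor loses less than 1, so one more copy of each projective point exceeds the upper bound.
    This gap is independent of [k], which yields the limit. *)
Lemma floor_bound_gap (q n m k : nat) : (1 < q)%N -> (0 < m)%N ->
  ((k - 1) * (q ^ n - 1) <= ((k - 1) * (q - 1) %/ (q ^ m - 1)
     * ((q ^ n - 1) %/ (q - 1)) + (q ^ n - 1) %/ (q - 1)) * (q ^ m - 1))%N.
Proof.
move=> q1 m0; have /dvdnP[N Nq] := dvdn_sub1_expn_sub1 q n.
have q10 : (0 < q - 1)%N by rewrite subn_gt0.
have Q0 : (0 < q ^ m - 1)%N := expn_sub1_gt0 q1 m0.
rewrite Nq mulnK// -mulSnr mulnAC mulnA mulnAC leq_mul2r.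
by rewrite (ltnW (ltn_ceil _ Q0)) orbT.
Qed.

(** Under the divisibility the quotient inside the floor is an integer, and the lower bound meets
    the upper one. *)
Lemma floor_bound_exact (q n m k T : nat) : (1 < q)%N -> (0 < m)%N ->
  ((k - 1) * (q - 1) %/ (q ^ m - 1) * ((q ^ n - 1) %/ (q - 1)) <= T)%N ->
  (T * (q ^ m - 1) <= (k - 1) * (q ^ n - 1))%N ->
  ((q ^ m - 1) %/ (q - 1) %| k - 1)%N ->
  (T * (q ^ m - 1) = (k - 1) * (q ^ n - 1))%N.
Proof.
move=> q1 m0 lower upper; have q10 : (0 < q - 1)%N by rewrite subn_gt0.
have Q0 : (0 < q ^ m - 1)%N := expn_sub1_gt0 q1 m0.
have /dvdnP[N Nq] := dvdn_sub1_expn_sub1 q n.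
have /dvdnP[d dq] := dvdn_sub1_expn_sub1 q m.
rewrite {1}dq mulnK// => /dvdnP[a ka]; apply/eqP; rewrite eqn_leq upper /=.
move: lower; rewrite ka -mulnA -dq mulnK// Nq mulnK// => lower.
by rewrite dq mulnACA leq_mul2r lower orbT.
Qed.

Local Open Scope classical_set_scope.
Local Open Scope ring_scope.
Theorem theorem1p4 (R : realType) (K : fieldType) (nu : K -> int)
    (F : finFieldType) (n k l : nat)
    (hnu : discrete_valuation nu) (hF : residue_field nu F)
    (hn : (1 <= n)%N) (hl : (2 <= l)%N) (hlk : (l <= k)%N) :
  let q := #|F| in
  let Theta_n j := Theta R q nu n j l in
  let Delta_n j := Delta R q nu n j l in
  (* the maxima exist *)
  (is_max_size (Theta_family R q nu n k l) (Theta_n k) /\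
   is_max_size (Delta_family R q nu n k l) (Delta_n k)) /\
  (* for l > n + 1 there are no l orthogonal vectors, Theta is k - 1, and only
     the lower bound survives *)
  (((k - 1) * (q - 1) %/ (q ^ (l - 1) - 1) * ((q ^ n - 1) %/ (q - 1))
      <= Theta_n k)%N /\
   ((l <= n + 1)%N ->
     [/\ (Theta_n k <= (k - 1) * (q ^ n - 1) %/ (q ^ (l - 1) - 1))%N,
         ((q ^ (l - 1) - 1) %/ (q - 1) %| k - 1)%N ->
           (Theta_n k)%:R = (k%:R - 1) / (q%:R ^+ (l - 1) - 1)
                              * (q%:R ^+ n - 1) :> R
       & (fun j : nat => (Theta_n j)%:R / j%:R : R) @ \oo -->
           ((q%:R ^+ n - 1) / (q%:R ^+ (l - 1) - 1) : R)])) /\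
  (* a pairwise orthogonal set of unit vectors has at most
     (q ^ n - 1) / (q - 1) elements; for
     3 <= l beyond that bound, Theta and Delta are both k - 1 *)
  ((l <= maxn 2 ((q ^ n - 1) %/ (q - 1)))%N ->
     (Theta_n k = Delta_n k <-> l = 2%N)) /\
  (Theta_n k = Ind F n k l -> (k <= q ^ (l - 1))%N).
Proof.
have [res resP] := hF.
move=> q Theta_n Delta_n; have q_gt1 : (1 < q)%N := finNzRing_gt1 F.
have l_gt0 : (0 < l)%N := ltnW hl.
have l1_gt0 : (0 < l - 1)%N by rewrite subn_gt0.
have Q_gt0 : (0 < q ^ (l - 1) - 1)%N := expn_sub1_gt0 q_gt1 l1_gt0.
have natr_expn m : q%:R ^+ m - 1 = (q ^ m - 1)%:R :> R.
  by rewrite natrB ?natrX// expn_gt0 (ltnW q_gt1).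
have cardP : #|points (fullv : {vspace 'rV[F]_n})| = ((q ^ n - 1) %/ (q - 1))%N.
  by rewrite card_pointsE dim_rV.
have lower j : (l <= j)%N -> ((j - 1) * (q - 1) %/ (q ^ (l - 1) - 1)
    * ((q ^ n - 1) %/ (q - 1)) <= Theta_n j)%N.
  exact: (Theta_ge_points R hnu resP hn hl).
have upper j : (l <= n + 1)%N -> (l <= j)%N ->
    (Theta_n j * (q ^ (l - 1) - 1) <= (j - 1) * (q ^ n - 1))%N.
  by move=> ln lj; exact: (Theta_upper R hnu resP hl lj ln).
split; first by split; [have [] := Theta_max R hnu resP n hl hlk
                       |have [] := Delta_max R hnu resP n hl hlk].
split.
  split=> [|ln]; first exact: lower.
  split; first by rewrite leq_divRL// upper.
    move=> dv; have := floor_bound_exact q_gt1 l1_gt0 (lower k hlk) (upper k ln hlk) dv.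
    move=> /(congr1 (fun m => m%:R : R)); rewrite !natrM !natr_expn => eqT.
    have -> : k%:R - 1 = (k - 1)%:R :> R by rewrite natrB// (leq_trans l_gt0).
    rewrite mulrAC -eqT mulfK//.
    by rewrite pnatr_eq0 -lt0n.
  rewrite !natr_expn.
  (* The first summand is the loss from the floor, the second comes from replacing [j - 1] by
     [j]. *)
  apply: (@cvg_natr_ratio _ _ _ _
    ((q ^ n - 1) %/ (q - 1) * (q ^ (l - 1) - 1) + (q ^ n - 1)) l) => // j lj.
  have j_gt0 : (0 < j)%N := leq_trans l_gt0 lj.
  apply/andP; split.
    by rewrite (leq_trans (upper j ln lj))// leq_mul2r leq_subr orbT.
  rewrite -{1}(subnK j_gt0) mulnDl mul1n addnA leq_add2r -mulnDl.
  apply: leq_trans (floor_bound_gap n j q_gt1 l1_gt0) _.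
  by rewrite leq_mul2r leq_add2r lower ?orbT.
split.
  move=> lN; split=> [eqTD|l2]; last first.
    by rewrite /Theta_n /Delta_n /Theta /Delta (Theta_family2 R nu F n k l2).
  apply/eqP; rewrite eqn_leq hl andbT leqNgt; apply/negP => l3.
  (* For [l >= 3] the maximum with 2 cannot be what bounds [l], so there are at least [l] points. *)
  move: lN; rewrite leq_max leqNgt l3 -cardP /= => lP.
  by have := Theta_lt_Delta R hnu resP hn hl hlk l3 lP; rewrite -/(Theta_n k) eqTD ltnn.
move=> eqTI; rewrite leqNgt; apply/negP => kq.
(* Equality would give [q ^ n <= q ^ n - 1], as [Ind] counts nonzero vectors only. *)
have := Theta_ge_card_rV R hnu resP hn hl hlk kq; rewrite -/(Theta_n k) eqTI.
move/leq_trans => /(_ _ (Ind_le F n k l)); rewrite leqNgt ltn_subrL/=.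
by rewrite expn_gt0 (ltnW q_gt1).
Qed.
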